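(* Let $\Gamma$ be a group, $R$ a $\Gamma$-graded ring, and $\delta$ a derivation of $R$. The differential polynomial ring $R[t;\delta]$ admits a good grading if and only if $\delta\in\mathrm{Der}_\gamma(R)$ for some $\gamma\in C_\Gamma(\Gamma_R)$. When this holds (for a given such $\gamma$), a good grading is given by $$R[t;\delta]_\tau:=\bigoplus_{i\ge 0}R_{\tau\gamma^{-i}}\,t^i\qquad(\tau\in\Gamma),$$ with $\deg(t)=\gamma$, and it is the only good grading on $R[t;\delta]$ with $\deg(t)=\gamma$.
   Context: Rings are associative with identity; $\Gamma$ is a (not necessarily abelian) group written multiplicatively, with identity $e$. A ring $R$ is $\Gamma$-graded if $R=\bigoplus_{\sigma\in\Gamma}R_\sigma$ with additive subgroups satisfying $R_\sigma R_\tau\subseteq R_{\sigma\tau}$ and $1_R\in R_e$. The support is $\Gamma_R=\{\sigma\in\Gamma: R_\sigma\neq0\}$, and $C_\Gamma(\Gamma_R)$ is the set of elements of $\Gamma$ commuting with every element of $\Gamma_R$. A derivation of $R$ is an additive map $\delta:R\to R$ with $\delta(xy)=\delta(x)y+x\delta(y)$. For $\gamma\in\Gamma$, $\mathrm{Der}_\gamma(R)$ is the set of derivations $\delta$ of $R$ with $\delta(R_\tau)\subseteq R_{\tau\gamma}$ for all $\tau\in\Gamma_R$. The ring $R[t;\delta]$ is the free left $R$-module with basis $\{t^k\}_{k\ge0}$ and multiplication determined by $tx=xt+\delta(x)$ for $x\in R$. A $\Gamma$-grading on the ring $R[t;\delta]$ is good if (i) the inclusion $R\hookrightarrow R[t;\delta]$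 is a graded ring homomorphism (it maps $R_\sigma$ into the degree-$\sigma$ component for every $\sigma$), and (ii) the relation $tx=xt+\delta(x)$ is homogeneous, i.e. $t$ is homogeneous and, for every homogeneous $x\in R$, the elements $tx$, $xt$ and $\delta(x)$ all lie in one common homogeneous component. ''$\deg(t)=\gamma$'' means that $t$ lies in the degree-$\gamma$ component. *)

(* Defs.v *)
From HB Require Import structures.
From mathcomp Require Import all_boot all_order all_algebra.
From mathcomp Require Import finmap monalg.

Set Implicit Arguments.
Unset Strict Implicit.
Unset Printing Implicit Defensive.

Import GRing.Theory.
Local Open Scope fset_scope.
Local Open Scope ring_scope.

Record derivation (R : pzRingType) := Derivation {
  der_fun :> {additive R -> R};
  derM : forall x y : R, der_fun (x * y) = der_fun x * y + x * der_fun y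
}.

(* The ring R[t; delta].  The element \sum_k a_k t^k of the free left
   R-module on {t^k} is represented by its family of coefficients
   a : nat -> R of finite support.  (The library's {poly R} is not used since
   it excludes the zero ring.) *)
Definition diffpoly (R : pzRingType) (delta : derivation R) : Type :=
  {malg R[nat]}.

Section DiffPoly.
Variables (R : pzRingType) (delta : derivation R).

HB.instance Definition _ :=
  GRing.Zmodule.copy (diffpoly delta) {malg R[nat]}.

Implicit Types f g h : diffpoly delta.

Definition dp_coef (k : nat) f : R := mcoeff (K := nat) k f.

Definition dp_monom (k : nat) (a : R) : diffpoly delta := mkmalgU (K := nat) k a.

Definition dp_supp f : {fset nat} := msupp (K := nat) f.

Lemma dp_coef_is_additive k : additive (dp_coef k).
Proof. by move=> f g; exact: raddfB. Qed.
HB.instance Definition _ k :=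
  GRing.isAdditive.Build (diffpoly delta) R (dp_coef k) (dp_coef_is_additive k).

Lemma dp_coefD k : {morph dp_coef k : f g / f + g}.
Proof. exact: raddfD. Qed.

Lemma dp_monom_is_additive k : additive (dp_monom k).
Proof. by move=> a b; exact: raddfB. Qed.
HB.instance Definition _ k :=
  GRing.isAdditive.Build R (diffpoly delta) (dp_monom k)
    (dp_monom_is_additive k).

Lemma dp_coef_monom i k a : dp_coef i (dp_monom k a) = a *+ (k == i).
Proof. exact: mcoeffU. Qed.

Lemma dp_coefP f g : (forall k, dp_coef k f = dp_coef k g) -> f = g.
Proof. by move=> efg; apply/malgP. Qed.

Lemma dp_coef_notin f k : k \notin dp_supp f -> dp_coef k f = 0.
Proof. exact: mcoeff_outdom. Qed.

Lemma dp_monomE f : f = \sum_(k <- dp_supp f) dp_monom k (dp_coef k f).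
Proof. exact: monalgE. Qed.

Lemma dp_sum_widen (V : zmodType) (F : nat -> R -> V) f (d : {fset nat}) :
  (forall k, F k 0 = 0) -> dp_supp f `<=` d ->
  \sum_(k <- dp_supp f) F k (dp_coef k f) = \sum_(k <- d) F k (dp_coef k f).
Proof.
move=> F0 sd; apply: big_fset_incl => // k _ /dp_coef_notin ->; exact: F0.
Qed.

Lemma dp_sum_additive (V : zmodType) (F : nat -> R -> V) :
  (forall k, additive (F k)) ->
  additive (fun f => \sum_(k <- dp_supp f) F k (dp_coef k f)).
Proof.
move=> addF f g.
have F0 k : F k 0 = 0 by have := addF k 0 0; rewrite !subr0 subrr.
set d := dp_supp f `|` dp_supp g `|` dp_supp (f - g).
rewrite !(@dp_sum_widen V F _ d) // /d.
- by rewrite -sumrB; apply: eq_bigr => k _; rewrite raddfB addF.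
- by rewrite -fsetUA (fsetUCA (dp_supp f)) fsubsetUl.
- by rewrite -fsetUA fsubsetUl.
- exact: fsubsetUr.
Qed.

Lemma dp_sum_monom (V : zmodType) (F : nat -> R -> V) k a :
  (forall i, F i 0 = 0) ->
  \sum_(i <- dp_supp (dp_monom k a)) F i (dp_coef i (dp_monom k a)) = F k a.
Proof.
move=> F0; rewrite (@dp_sum_widen _ F _ [fset k]) //; last exact: msuppU_le.
by rewrite big_seq_fset1 dp_coef_monom eqxx.
Qed.

Definition dp_scale (a : R) f : diffpoly delta :=
  \sum_(k <- dp_supp f) dp_monom k (a * dp_coef k f).

Lemma dp_coef_scale a f k : dp_coef k (dp_scale a f) = a * dp_coef k f.
Proof.
rewrite /dp_scale [in RHS](dp_monomE f) !raddf_sum mulr_sumr.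
by apply: eq_bigr => i _ /=; rewrite !dp_coef_monom mulrnAr.
Qed.

Lemma dp_scaleA a b f : dp_scale a (dp_scale b f) = dp_scale (a * b) f.
Proof. by apply: dp_coefP => k; rewrite !dp_coef_scale mulrA. Qed.

Lemma dp_scale1 : left_id 1 dp_scale.
Proof. by move=> f; apply: dp_coefP => k; rewrite dp_coef_scale mul1r. Qed.

Lemma dp_scaleDr : right_distributive dp_scale +%R.
Proof.
by move=> a f g; apply: dp_coefP => k; rewrite !(dp_coefD, dp_coef_scale) mulrDr.
Qed.

Lemma dp_scaleDl f : {morph dp_scale^~ f : a b / a + b}.
Proof.
by move=> a b; apply: dp_coefP => k; rewrite !(dp_coefD, dp_coef_scale) mulrDl.
Qed.

HB.instance Definition _ := GRing.Zmodule_isLmodule.Build R (diffpoly delta)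
  dp_scaleA dp_scale1 dp_scaleDr dp_scaleDl.

Lemma dp_coefZ a f k : dp_coef k (a *: f) = a * dp_coef k f.
Proof. exact: dp_coef_scale. Qed.

Lemma dp_monomZ a b k : a *: dp_monom k b = dp_monom k (a * b).
Proof.
by apply: dp_coefP => i; rewrite dp_coefZ !dp_coef_monom mulrnAr.
Qed.

(* Left multiplication by t: t (a t^k) = a t^(k+1) + delta(a) t^k. *)
Definition dp_lmult f : diffpoly delta :=
  \sum_(k <- dp_supp f)
    (dp_monom k.+1 (dp_coef k f) + dp_monom k (delta (dp_coef k f))).

(* (\sum_k a_k t^k) g = \sum_k a_k (t (t (... (t g)))), with k factors t. *)
Definition dp_mul f g : diffpoly delta :=
  \sum_(k <- dp_supp f) dp_coef k f *: iter k dp_lmult g.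

Definition dp_one : diffpoly delta := dp_monom 0 1.

Lemma dp_lmult_is_additive : additive dp_lmult.
Proof.
apply: (@dp_sum_additive _ (fun k a => dp_monom k.+1 a + dp_monom k (delta a))).
by move=> k a b; rewrite !raddfB opprD !addrA; congr (_ + _); rewrite addrAC.
Qed.
HB.instance Definition _ :=
  GRing.isAdditive.Build (diffpoly delta) (diffpoly delta) dp_lmult
    dp_lmult_is_additive.

Lemma iter_dp_lmult_is_additive k : additive (iter k dp_lmult).
Proof. by elim: k => [|k IHk] f g //=; rewrite IHk raddfB. Qed.
HB.instance Definition _ k :=
  GRing.isAdditive.Build (diffpoly delta) (diffpoly delta) (iter k dp_lmult)
    (iter_dp_lmult_is_additive k).

Lemma dp_lmult_monom k a :
  dp_lmult (dp_monom k a) = dp_monom k.+1 a + dp_monom k (delta a).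
Proof.
rewrite /dp_lmult.
rewrite (@dp_sum_monom _ (fun k a => dp_monom k.+1 a + dp_monom k (delta a))) //.
by move=> i; rewrite !raddf0 addr0.
Qed.

Lemma dp_lmult_sum (I : Type) (r : seq I) (F : I -> diffpoly delta) :
  dp_lmult (\sum_(i <- r) F i) = \sum_(i <- r) dp_lmult (F i).
Proof. exact: raddf_sum. Qed.

Lemma dp_lmultZ a f : dp_lmult (a *: f) = a *: dp_lmult f + delta a *: f.
Proof.
rewrite [f]dp_monomE dp_lmult_sum !scaler_sumr dp_lmult_sum -big_split.
apply: eq_bigr => k _ /=.
rewrite dp_monomZ !dp_lmult_monom scalerDr !dp_monomZ derM raddfD /=.
by rewrite -!addrA; congr (_ + _); rewrite addrC.
Qed.

Lemma dp_mul_is_additive g : additive (dp_mul^~ g).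
Proof.
apply: (@dp_sum_additive _ (fun k a => a *: iter k dp_lmult g)) => k a b.
exact: scalerBl.
Qed.

Lemma dp_mul_sum (I : Type) (r : seq I) (F : I -> diffpoly delta) g :
  dp_mul (\sum_(i <- r) F i) g = \sum_(i <- r) dp_mul (F i) g.
Proof.
have add0 : dp_mul 0 g = 0.
  by have := dp_mul_is_additive g 0 0; rewrite !subr0 subrr.
apply: (big_morph (dp_mul^~ g)) => // f h.
have addN : dp_mul (- h) g = - dp_mul h g.
  by have := dp_mul_is_additive g 0 h; rewrite add0 !sub0r.
by have := dp_mul_is_additive g f (- h); rewrite opprK addN opprK.
Qed.

Lemma dp_mul_monom k a g : dp_mul (dp_monom k a) g = a *: iter k dp_lmult g.
Proof.
rewrite /dp_mul (@dp_sum_monom _ (fun k a => a *: iter k dp_lmult g)) //.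
by move=> i; rewrite scale0r.
Qed.

Lemma dp_mulZ a f g : dp_mul (a *: f) g = a *: dp_mul f g.
Proof.
rewrite [f]dp_monomE scaler_sumr !dp_mul_sum scaler_sumr.
by apply: eq_bigr => k _; rewrite dp_monomZ !dp_mul_monom scalerA.
Qed.

Lemma dp_mul_lmult f g : dp_mul (dp_lmult f) g = dp_lmult (dp_mul f g).
Proof.
rewrite [f]dp_monomE dp_lmult_sum !dp_mul_sum dp_lmult_sum.
apply: eq_bigr => k _; rewrite dp_lmult_monom.
have -> b c : dp_mul (b + c) g = dp_mul b g + dp_mul c g.
  have := dp_mul_sum [:: b; c] id g.
  by rewrite !big_cons !big_nil !addr0.
by rewrite !dp_mul_monom dp_lmultZ.
Qed.

Lemma dp_mulA : associative dp_mul.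
Proof.
move=> f g h; rewrite [f]dp_monomE !dp_mul_sum; apply: eq_bigr => k _.
rewrite !dp_mul_monom dp_mulZ; congr (_ *: _).
by elim: k => //= k ->; rewrite dp_mul_lmult.
Qed.

Lemma dp_mul1 : left_id dp_one dp_mul.
Proof. by move=> f; rewrite dp_mul_monom scale1r. Qed.

Lemma der1 : delta 1 = 0.
Proof.
by apply: (addrI (delta 1)); rewrite -{3}[1]mulr1 derM mulr1 mul1r addr0.
Qed.

Lemma iter_dp_lmult1 k : iter k dp_lmult dp_one = dp_monom k 1.
Proof.
by elim: k => //= k ->; rewrite dp_lmult_monom der1 raddf0 addr0.
Qed.

Lemma dp_mulr1 : right_id dp_one dp_mul.
Proof.
move=> f; rewrite [RHS]dp_monomE; apply: eq_bigr => k _.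
by rewrite iter_dp_lmult1 dp_monomZ mulr1.
Qed.

Lemma dp_mulDl : left_distributive dp_mul +%R.
Proof.
move=> f g h; have := dp_mul_sum [:: f; g] id h.
by rewrite !big_cons !big_nil !addr0.
Qed.

Lemma dp_mulDr : right_distributive dp_mul +%R.
Proof.
move=> f g h; rewrite /dp_mul -big_split; apply: eq_bigr => k _ /=.
by rewrite raddfD scalerDr.
Qed.

HB.instance Definition _ := GRing.Zmodule_isPzRing.Build (diffpoly delta)
  dp_mulA dp_mul1 dp_mulr1 dp_mulDl dp_mulDr.

Definition dpC (x : R) : diffpoly delta := dp_monom 0 x.

Definition dpT : diffpoly delta := dp_monom 1 1.

Lemma dpC_mull x f : dpC x * f = x *: f.
Proof. exact: dp_mul_monom. Qed.

Lemma dpC_is_additive : additive dpC.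
Proof. exact: raddfB. Qed.
HB.instance Definition _ :=
  GRing.isAdditive.Build R (diffpoly delta) dpC dpC_is_additive.

Lemma dpC_is_monoid_morphism : monoid_morphism dpC.
Proof. by split=> // x y; rewrite dpC_mull dp_monomZ. Qed.
HB.instance Definition _ :=
  GRing.isMonoidMorphism.Build R (diffpoly delta) dpC dpC_is_monoid_morphism.

Lemma dpT_mull f : dpT * f = dp_lmult f.
Proof. by rewrite [LHS]dp_mul_monom scale1r. Qed.

Lemma dpTX k : dpT ^+ k = dp_monom k 1.
Proof.
elim: k => // k IHk.
by rewrite exprS IHk dpT_mull dp_lmult_monom der1 raddf0 addr0.
Qed.

Lemma dp_monomTX k a : dp_monom k a = dpC a * dpT ^+ k.
Proof. by rewrite dpTX dpC_mull dp_monomZ mulr1. Qed.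

Lemma dpT_comm x : dpT * dpC x = dpC x * dpT + dpC (delta x).
Proof. by rewrite dpT_mull dp_lmult_monom -[dpT]expr1 -dp_monomTX. Qed.

Lemma dp_basisE f : f = \sum_(k <- dp_supp f) dp_coef k f *: dpT ^+ k.
Proof.
by rewrite [LHS]dp_monomE; apply: eq_bigr => k _; rewrite dp_monomTX dpC_mull.
Qed.

Lemma dp_basis_free n (a : 'I_n -> R) :
  \sum_(k < n) a k *: dpT ^+ k = 0 -> forall k, a k = 0.
Proof.
move=> /(congr1 (dp_coef _)) sum0 k; have := sum0 k; rewrite raddf0 raddf_sum.
rewrite (bigD1 k) //= big1 => [|i /negPf nik]; rewrite dpTX dp_coefZ dp_coef_monom.
  by rewrite eqxx mulr1 addr0.
by rewrite -val_eqE in nik; rewrite nik mulr0.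
Qed.

End DiffPoly.

Arguments dpC {R delta} x.
Arguments dpT {R delta}.

Section Gradings.
Variable Gamma : groupType.

(* S is the internal direct sum of the homogeneous components
   B sigma = {x | B sigma x}. *)
Record is_grading (S : pzRingType) (B : Gamma -> S -> Prop) : Prop := {
  grad0 : forall sigma, B sigma 0;
  gradB : forall sigma x y, B sigma x -> B sigma y -> B sigma (x - y);
  grad_span : forall x : S, exists n (s : 'I_n -> Gamma) (y : 'I_n -> S),
    (forall i, B (s i) (y i)) /\ x = \sum_(i < n) y i;
  grad_free : forall n (s : 'I_n -> Gamma) (y : 'I_n -> S),
    injective s -> (forall i, B (s i) (y i)) -> \sum_(i < n) y i = 0 ->
    forall i, y i = 0;
  gradM : forall sigma tau x y,
    B sigma x -> B tau y -> B (sigma * tau)%g (x * y);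
  grad1 : B 1%g 1
}.

Definition homogeneous (S : pzRingType) (B : Gamma -> S -> Prop) (x : S) :=
  exists sigma, B sigma x.

Definition gsupp (S : pzRingType) (B : Gamma -> S -> Prop) (sigma : Gamma) :=
  exists x, B sigma x /\ x <> 0.

Definition centralizer (P : Gamma -> Prop) (gamma : Gamma) :=
  forall sigma, P sigma -> commute gamma sigma.

Variables (R : pzRingType) (A : Gamma -> R -> Prop) (delta : derivation R).

(* delta \in Der_gamma(R) *)
Definition homogeneous_der (gamma : Gamma) :=
  forall tau, gsupp A tau -> forall x, A tau x -> A (tau * gamma)%g (delta x).

Record good_grading (B : Gamma -> diffpoly delta -> Prop) : Prop := {
  good_is_grading : is_grading B;
  good_incl : forall sigma x, A sigma x -> B sigma (dpC x);
  good_dpT : homogeneous B dpT;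
  good_rel : forall x, homogeneous A x -> exists rho,
    [/\ B rho (dpT * dpC x), B rho (dpC x * dpT) & B rho (dpC (delta x))]
}.

Definition diffpoly_grading (gamma tau : Gamma) (f : diffpoly delta) :=
  exists n (a : 'I_n -> R),
    (forall i : 'I_n, A (tau * gamma ^- i)%g (a i)) /\
    f = \sum_(i < n) dpC (a i) * dpT ^+ i.

End Gradings.

(* Main.v *)
Require Import Defs.
From mathcomp Require Import all_boot all_order all_algebra.
From mathcomp Require Import finmap.

(** Let [t] have degree [gamma] in a good grading.  For a nonzero [x] of degree
    [sigma], the elements [x t] and [t x = x t + delta x] both have the nonzero
    coefficient [x] at [t], hence are nonzero homogeneous elements, of degrees
    [sigma * gamma] and [gamma * sigma].  Since they lie in one component, the
    two degrees agree, so [gamma] centralizes the support, and [delta x] lies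
    in the component of degree [sigma * gamma].  That [delta x] then has degree
    [sigma * gamma] in [R] itself is an instance of [grading_reflect]: an
    injective additive map which preserves degrees also reflects them.

    Conversely, membership of [f] in the candidate component of degree [tau] is
    a condition on each coefficient separately: the [k]-th one has degree
    [tau * gamma ^- k] ([diffpoly_gradingP]).  This reduces the direct sum
    decomposition to the one of [R].  For products, left multiplication by [t]
    raises degrees by [gamma] because [delta] does ([diffpoly_grading_lmult]),
    and moving a power of [gamma] past the degree of a nonzero coefficient is
    what centrality allows ([diffpoly_gradingM]).

    For uniqueness, any good grading with [deg t = gamma] contains every
    [a t^i] in the expected component, so it is componentwise larger than the
    candidate; [grading_reflect] for the identity map shows that two comparable
    gradings are equal. *)

Set Implicit Arguments.
Unset Strict Implicit.
Unset Printing Implicit Defensive.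

Import GRing.Theory.
Local Open Scope ring_scope.

(** * Decompositions in a graded ring *)

Section Grading.
Variables (Gamma : groupType) (S : pzRingType) (B : Gamma -> S -> Prop).
Hypothesis hB : is_grading B.

Lemma gradN sigma x : B sigma x -> B sigma (- x).
Proof. by move=> Bx; rewrite -sub0r; apply: gradB Bx => //; exact: grad0. Qed.

Lemma gradD sigma x y : B sigma x -> B sigma y -> B sigma (x + y).
Proof. by move=> Bx By; rewrite -[y]opprK; apply: gradB => //; exact: gradN. Qed.

Lemma grad_sum sigma (I : Type) (r : seq I) (P : pred I) (F : I -> S) :
  (forall i, P i -> B sigma (F i)) -> B sigma (\sum_(i <- r | P i) F i).
Proof.
by move=> BF; elim/big_rec: _ => [|i x Pi]; [exact: grad0|apply: gradD; exact: BF].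
Qed.

Lemma gradX sigma x k : B sigma x -> B (sigma ^+ k)%g (x ^+ k).
Proof.
move=> Bx; elim: k => [|k IHk]; first exact: grad1.
by rewrite exprS expgS; exact: gradM.
Qed.

(** The form of directness that applies to the decompositions provided by
    [grad_span], where degrees may be repeated: terms of equal degree are
    collected first. *)
Lemma grad_free_collect n (s : 'I_n -> Gamma) (y : 'I_n -> S) :
    (forall i, B (s i) (y i)) -> \sum_(i < n) y i = 0 ->
  forall sigma, \sum_(i < n | s i == sigma) y i = 0.
Proof.
move=> By y0 sigma; pose r := undup (codom s).
have r_s i : s i \in r by rewrite mem_undup codom_f.
have [rsigma|rNsigma] := boolP (sigma \in r); last first.
  by rewrite big_pred0 // => i; apply: contraNF rNsigma => /eqP <-.
pose s' (j : 'I_(size r)) := nth sigma r j.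
pose y' j := \sum_(i < n | s i == s' j) y i.
have s'_inj : injective s'.
  by move=> i j /eqP; rewrite nth_uniq ?undup_uniq // => /eqP/val_inj.
have By' j : B (s' j) (y' j) by apply: grad_sum => i /eqP <-.
have y'0 : \sum_j y' j = 0.
  rewrite -[RHS]y0 -(big_mkord xpredT (fun j => \sum_(i < n | s i == nth sigma r j) y i)).
  rewrite -(big_nth sigma xpredT (fun x => \sum_(i < n | s i == x) y i)).
  rewrite (exchange_big_dep xpredT) //=; apply: eq_bigr => i _.
  under eq_bigl => x do rewrite eq_sym.
  by rewrite -big_filter filter_pred1_uniq ?undup_uniq ?r_s ?big_seq1.
have := grad_free hB s'_inj By' y'0 (Ordinal (etrans (index_mem _ _) rsigma)).
by rewrite /y' /s' /= nth_index.
Qed.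

(** Apply [grad_free_collect] to the decomposition of [0] obtained by adding
    [- x], in degree [sigma], as an extra term. *)
Lemma grad_component n (s : 'I_n -> Gamma) (y : 'I_n -> S) sigma x :
    (forall i, B (s i) (y i)) -> x = \sum_(i < n) y i -> B sigma x ->
  x = \sum_(i < n | s i == sigma) y i.
Proof.
move=> By xE Bx.
pose s' (i : 'I_n.+1) := oapp s sigma (unlift ord0 i).
pose y' (i : 'I_n.+1) := oapp y (- x) (unlift ord0 i).
have By' i : B (s' i) (y' i).
  by rewrite /s' /y'; case: unliftP => [j|] _ //=; exact: gradN.
have y'0 : \sum_i y' i = 0.
  rewrite big_ord_recl {1}/y' unlift_none [X in _ + X](_ : _ = x) ?addNr //.
  by rewrite xE; apply: eq_bigr => i _; rewrite /y' liftK.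
have := grad_free_collect By' y'0 sigma.
rewrite big_mkcond big_ord_recl {1}/s' {1}/y' unlift_none eqxx /= => /eqP.
rewrite addrC subr_eq0 => /eqP <-; rewrite [RHS]big_mkcond.
by apply: eq_bigr => i _; rewrite /s' /y' liftK.
Qed.

Lemma grad_disjoint sigma tau x : B sigma x -> B tau x -> x <> 0 -> sigma = tau.
Proof.
move=> Bsx Btx x0; apply/eqP; apply: contra_notT x0 => /negPf nst.
have xE : x = \sum_(i < 1) x by rewrite big_ord1.
rewrite (grad_component (s := fun=> sigma) (fun=> Bsx) xE Btx).
by rewrite big_pred0.
Qed.

End Grading.

(** Decompose [x] in the source: by uniqueness in the target, only the terms of
    degree [sigma] contribute to the image, hence, by injectivity, to [x]. *)
Lemma grading_reflect (Gamma : groupType) (S S' : pzRingType)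
    (B : Gamma -> S -> Prop) (B' : Gamma -> S' -> Prop)
    (phi : {additive S -> S'}) :
    is_grading B -> is_grading B' -> injective phi ->
    (forall sigma x, B sigma x -> B' sigma (phi x)) ->
  forall sigma x, B' sigma (phi x) -> B sigma x.
Proof.
move=> hB hB' phi_inj phiB sigma x B'x.
have [n [s [y [By xE]]]] := grad_span hB x.
have B'y i : B' (s i) (phi (y i)) by exact: phiB.
have phixE : phi x = \sum_(i < n) phi (y i) by rewrite xE raddf_sum.
have := grad_component hB' B'y phixE B'x; rewrite -raddf_sum => /phi_inj ->.
by apply: grad_sum => // i /eqP <-.
Qed.

(** * The degree of the variable in a good grading *)

Section DiffPolyGrading.
Variables (Gamma : groupType) (R : pzRingType) (A : Gamma -> R -> Prop).
Hypothesis hA : is_grading A.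
Variable delta : derivation R.
Implicit Types f g : diffpoly delta.

Lemma dpC_inj : injective (dpC : R -> diffpoly delta).
Proof.
by move=> x y /(congr1 (dp_coef 0)); rewrite !dp_coef_monom.
Qed.

(** The nonzero coefficient [x] at [t] shows that neither [x t] nor [t x]
    vanishes, so that their common component determines a degree. *)
Lemma good_grading_degree (B : Gamma -> diffpoly delta -> Prop) gamma :
    good_grading A B -> B gamma dpT ->
  centralizer (gsupp A) gamma /\ homogeneous_der A delta gamma.
Proof.
move=> gB Bt; have hB := good_is_grading gB.
have deg sigma x : A sigma x -> x <> 0 ->
    (gamma * sigma = sigma * gamma /\ B (sigma * gamma) (dpC (delta x)))%g.
  move=> Ax x0; have Bx := good_incl gB Ax.
  have [rho [Btx Bxt Bdx]] : exists rho, [/\ B rho (dpT * dpC x),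
      B rho (dpC x * dpT) & B rho (dpC (delta x))].
    by apply: (good_rel gB); exists sigma.
  have coef_xt : dp_coef 1 (dpC x * dpT : diffpoly delta) = x.
    by rewrite -[dpT]expr1 -dp_monomTX dp_coef_monom.
  have coef_tx : dp_coef 1 (dpT * dpC x : diffpoly delta) = x.
    by rewrite dpT_comm dp_coefD coef_xt dp_coef_monom addr0.
  have rho_xt : rho = (sigma * gamma)%g.
    apply: (grad_disjoint hB Bxt (gradM hB Bx Bt)) => xt0.
    by apply: x0; rewrite -coef_xt xt0 raddf0.
  have rho_tx : rho = (gamma * sigma)%g.
    apply: (grad_disjoint hB Btx (gradM hB Bt Bx)) => tx0.
    by apply: x0; rewrite -coef_tx tx0 raddf0.
  by rewrite -rho_tx -rho_xt.
split=> [sigma [x [Ax x0]]|sigma _ x Ax]; first by case: (deg sigma x Ax x0).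
have [->|/eqP x0] := eqVneq x 0; first by rewrite raddf0; exact: grad0.
apply: (grading_reflect hA hB dpC_inj); first exact: good_incl gB.
by case: (deg sigma x Ax x0).
Qed.

(** * The grading determined by a degree of the variable *)

Variable gamma : Gamma.
Local Notation D := (diffpoly_grading A (delta := delta) gamma).

Lemma diffpoly_gradingP tau f :
  D tau f <-> forall k, A (tau * gamma ^- k)%g (dp_coef k f).
Proof.
split=> [[n [a [Aa ->]]] k|Af].
  rewrite raddf_sum; apply: grad_sum => // i _ /=.
  rewrite -dp_monomTX dp_coef_monom.
  by case: eqP => [<-|_]; [exact: Aa|exact: grad0].
exists (\max_(k <- dp_supp f) k).+1, (fun i => dp_coef i f); split=> [i|] //.
set n := _.+1; apply: dp_coefP => k; rewrite raddf_sum /=.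
under eq_bigr => i _ do rewrite -dp_monomTX dp_coef_monom.
have [kn|nk] := ltnP k n.
  rewrite (bigD1 (Ordinal kn)) //= eqxx big1 ?addr0 // => i.
  by rewrite -val_eqE /= => /negPf ->.
rewrite big1 => [|i _]; last by rewrite ltn_eqF // (leq_trans _ nk).
apply: dp_coef_notin; apply: contraL nk => fk.
by rewrite -ltnNge ltnS (leq_bigmax_seq k).
Qed.

Lemma diffpoly_gradingD tau f g : D tau f -> D tau g -> D tau (f + g).
Proof.
move=> /diffpoly_gradingP Df /diffpoly_gradingP Dg.
by apply/diffpoly_gradingP => k; rewrite dp_coefD; exact: gradD.
Qed.

Lemma diffpoly_grading_sum tau (I : Type) (r : seq I) (F : I -> diffpoly delta) :
  (forall i, D tau (F i)) -> D tau (\sum_(i <- r) F i).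
Proof.
move=> DF; apply/diffpoly_gradingP => k; rewrite raddf_sum.
by apply: grad_sum => // i _; apply: (diffpoly_gradingP _ _).1.
Qed.

Lemma diffpoly_grading_monom tau k a :
  A tau a -> D (tau * gamma ^+ k)%g (dp_monom delta k a).
Proof.
move=> Aa; apply/diffpoly_gradingP => i; rewrite dp_coef_monom.
by case: eqP => [<-|_]; [rewrite mulgK|exact: grad0].
Qed.

Lemma diffpoly_grading_dpC tau a : A tau a -> D tau (dpC a).
Proof. by move/(@diffpoly_grading_monom _ 0); rewrite mulg1. Qed.

Lemma diffpoly_grading_dpT : D gamma dpT.
Proof. by have := diffpoly_grading_monom 1 (grad1 hA); rewrite mul1g. Qed.

Lemma diffpoly_grading_span f :
  exists n (s : 'I_n -> Gamma) (y : 'I_n -> diffpoly delta),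
    (forall i, D (s i) (y i)) /\ f = \sum_(i < n) y i.
Proof.
rewrite [f]dp_monomE; elim/big_rec: _ => [|k g _ [n [s [y [Dy ->]]]]].
  by exists 0, (fun=> 1%g), (fun=> 0); split=> [[]|] //; rewrite big_ord0.
have [m [s' [y' [Ay' ->]]]] := grad_span hA (dp_coef k f).
exists (m + n)%N,
  (fun i => match split i with inl j => s' j * gamma ^+ k | inr j => s j end)%g,
  (fun i => match split i with inl j => dp_monom delta k (y' j) | inr j => y j end).
split=> [i|]; first by case: (split i) => j //; exact: diffpoly_grading_monom.
rewrite big_split_ord raddf_sum.
congr (_ + _); apply: eq_bigr => i _.
  by rewrite (unsplitK (inl i)).
by rewrite (unsplitK (inr i)).
Qed.

Lemma diffpoly_grading_free n (s : 'I_n -> Gamma) (y : 'I_n -> diffpoly delta) :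
    injective s -> (forall i, D (s i) (y i)) -> \sum_(i < n) y i = 0 ->
  forall i, y i = 0.
Proof.
move=> s_inj Dy y0 i; apply: dp_coefP => k; rewrite raddf0.
pose s' j := (s j * gamma ^- k)%g.
apply: (grad_free hA (s := s') (y := fun j => dp_coef k (y j))).
- by move=> j1 j2 /= sj; apply: s_inj; exact: mulIg sj.
- by move=> j; apply: (diffpoly_gradingP _ _).1.
- by rewrite -raddf_sum y0 raddf0.
Qed.

Hypothesis gamma_central : centralizer (gsupp A) gamma.
Hypothesis delta_gamma : homogeneous_der A delta gamma.

(** If [tau] lies outside the support, then [x] vanishes, and so does
    [delta x]. *)
Lemma homogeneous_derP tau x : A tau x -> A (tau * gamma)%g (delta x).
Proof.
move=> Ax; have [->|/eqP x0] := eqVneq x 0; first by rewrite raddf0; exact: grad0.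
by apply: delta_gamma => //; exists x.
Qed.

(** Both terms of [t (a t^k) = a t^(k+1) + delta a t^k] have degree
    [deg a * gamma ^+ k.+1]. *)
Lemma diffpoly_grading_lmult tau f :
  D tau f -> D (tau * gamma)%g (dp_lmult f).
Proof.
move/diffpoly_gradingP=> Df; apply: diffpoly_grading_sum => k.
apply: diffpoly_gradingD.
  have := diffpoly_grading_monom k.+1 (Df k).
  by rewrite expgSr !mulgA mulgVK.
have := diffpoly_grading_monom k (homogeneous_derP (Df k)).
by rewrite -!mulgA -expgS expgSr mulKg.
Qed.

(** For a coefficient [b] of [t^k g] at [t^j], the degree of [b] is
    [rho = tau * gamma ^+ k * gamma ^- j]; a coefficient [a] of [f] at [t^k] has
    degree [sigma * gamma ^- k], so [gamma ^- k] has to be moved past [rho],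
    which is possible since [rho] is in the support unless [b] vanishes. *)
Lemma diffpoly_gradingM sigma tau f g :
  D sigma f -> D tau g -> D (sigma * tau)%g (f * g).
Proof.
move=> /diffpoly_gradingP Df Dg; apply: diffpoly_grading_sum => k.
have /diffpoly_gradingP Dtg : D (tau * gamma ^+ k)%g (iter k (@dp_lmult _ delta) g).
  elim: k => [|k IHk]; first by rewrite mulg1.
  by rewrite expgSr mulgA; exact: diffpoly_grading_lmult.
apply/diffpoly_gradingP => j; rewrite dp_coefZ.
set b := dp_coef j _; have Ab : A _ b := Dtg j.
have [->|/eqP b0] := eqVneq b 0; first by rewrite mulr0; exact: grad0.
have := gradM hA (Df k) Ab; set rho := (tau * _ * _)%g in Ab *.
have rhoC : commute (gamma ^- k)%g rho.
  apply/commute_sym/commuteV/commuteX/commute_sym.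
  by apply: gamma_central; exists b.
rewrite -mulgA rhoC /rho; congr (A _ _); rewrite -!mulgA; congr (_ * (_ * _))%g.
have jkC : commute (gamma ^- j)%g (gamma ^- k)%g.
  by apply/commuteV/commute_sym/commuteV/commuteX2.
by rewrite jkC mulVKg.
Qed.

Lemma diffpoly_grading_is_grading : is_grading D.
Proof.
split.
- by move=> tau; apply/diffpoly_gradingP => k; rewrite raddf0; exact: grad0.
- move=> tau f g /diffpoly_gradingP Df /diffpoly_gradingP Dg.
  by apply/diffpoly_gradingP => k; rewrite raddfB; exact: gradB.
- exact: diffpoly_grading_span.
- exact: diffpoly_grading_free.
- exact: diffpoly_gradingM.
- exact: diffpoly_grading_dpC (grad1 hA).
Qed.

Lemma diffpoly_grading_good : good_grading A D.
Proof.
split.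
- exact: diffpoly_grading_is_grading.
- exact: diffpoly_grading_dpC.
- by exists gamma; exact: diffpoly_grading_dpT.
move=> x [sigma Ax]; exists (sigma * gamma)%g.
have Dxt : D (sigma * gamma)%g (dpC x * dpT).
  apply: diffpoly_gradingM; [exact: diffpoly_grading_dpC|].
  exact: diffpoly_grading_dpT.
have Ddx : D (sigma * gamma)%g (dpC (delta x)).
  exact/diffpoly_grading_dpC/homogeneous_derP.
by split=> //; rewrite dpT_comm; exact: diffpoly_gradingD.
Qed.

Lemma diffpoly_grading_unique (B : Gamma -> diffpoly delta -> Prop) :
    good_grading A B -> B gamma dpT ->
  forall tau f, B tau f <-> D tau f.
Proof.
move=> gB Bt; have hB := good_is_grading gB.
have DB tau f : D tau f -> B tau f.
  case=> n [a [Aa ->]]; apply: grad_sum => // i _; rewrite -(mulgVK (gamma ^+ i)%g tau).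
  apply: gradM => //; [exact: good_incl gB _ _ (Aa i)|exact: gradX].
move=> tau f; split=> [Btf|/DB //].
exact: (grading_reflect (phi := idfun) diffpoly_grading_is_grading hB _ DB Btf).
Qed.

End DiffPolyGrading.

Theorem theorem1p2 (Gamma : groupType) (R : pzRingType)
    (A : Gamma -> R -> Prop) (hA : is_grading A) (delta : derivation R) :
  ((exists B : Gamma -> diffpoly delta -> Prop, good_grading A B) <->
   (exists gamma : Gamma,
      centralizer (gsupp A) gamma /\ homogeneous_der A delta gamma)) /\
  (forall gamma : Gamma,
     centralizer (gsupp A) gamma -> homogeneous_der A delta gamma ->
     [/\ good_grading A (diffpoly_grading A (delta := delta) gamma),
         diffpoly_grading A gamma gamma (dpT : diffpoly delta)
       & forall B : Gamma -> diffpoly delta -> Prop,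
           good_grading A B -> B gamma dpT ->
           forall (tau : Gamma) (f : diffpoly delta),
             B tau f <-> diffpoly_grading A gamma tau f]).
Proof.
split; last first.
  move=> gamma cg dg; split.
  - exact: diffpoly_grading_good.
  - exact: diffpoly_grading_dpT.
  - by move=> B; exact: diffpoly_grading_unique.
split=> [[B gB]|[gamma [cg dg]]].
  have [gamma Bt] := good_dpT gB.
  by exists gamma; exact: good_grading_degree gB Bt.
by exists (diffpoly_grading A (delta := delta) gamma); exact: diffpoly_grading_good.
Qed.
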